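(* Let $M,N$ be positive integers with $N<M$ and $M$ even, and let $P=\sum_{j=0}^{M/2}\zeta_{2j}\partial_x^{2j}$ with $\zeta_{2j}\in\mathbb R$, $\zeta_M\ne0$. Let $f$ satisfy the standing assumptions on $f$ stated in the context, let $B$ be the real matrix defining the boundary conditions $BY^x(0,t)=0$, and let $\mathcal C$ be the associated compatibility set. (1) If the boundary conditions $BY^x(0,t)=0$ reduce to $\partial_x^{2j}y(0,t)=0$ for all $j\in\mathbb N$ with $2j\le M-1$, and if for all $x\in[-1,1]$ and all $(y_0,\dots,y_{M-1})\in(-4,4)^{M}$ $$f(-x,-y_0,y_1,\dots,(-1)^{i+1}y_i,\dots,y_{M-1})=-f(x,y_0,\dots,y_{M-1}),$$ then $$\mathcal C=\{Y_0=(y_0,y_1,\dots,y_{N-1})\in C^\infty([0,1])^N:\ \partial_x^{2j}y_l(0)=0\ \ \forall j\in\mathbb N,\ \forall l=0,\dots,N-1\}.$$ (2) If the boundary conditions $BY^x(0,t)=0$ reduce to $\partial_x^{2j+1}y(0,t)=0$ for all $j\in\mathbb N$ with $2j+1\le M-1$, and if for all $x\in[-1,1]$ and all $(y_0,\dots,y_{M-1})\in(-4,4)^{M}$ $$f(-x,y_0,-y_1,\dots,(-1)^{i}y_i,\dots,-y_{M-1})=f(x,y_0,\dots,y_{M-1}),$$ then $$\mathcal C=\{Y_0=(y_0,y_1,\dots,y_{N-1})\in C^\infty([0,1])^N:\ \partial_x^{2j+1}y_l(0)=0\ \ \forall j\in\mathbb N,\ \forall l=0,\dots,N-1\}.$$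
   Context: The PDE considered is $\partial_t^Ny=Py+f(x,y,\partial_xy,\dots,\partial_x^{M-1}y)$, with $y$ real-valued. Notation: $Y^x=(y,\partial_xy,\dots,\partial_x^{M-1}y)$, $Y^t=(y,\partial_ty,\dots,\partial_t^{N-1}y)$; functions in $C^\infty([0,1])$ are real-valued. Standing assumptions on $f$: $f\in C^\infty(\mathbb R^{M+1};\mathbb R)$, $f(x,0,\dots,0)=0$ for all $x\in(-4,4)$, and for $(x,\vec y)=(x,y_0,\dots,y_{M-1})\in(-4,4)^{M+1}$, $$f(x,\vec y)=\sum_{(\vec p,r)\in\mathbb N^{M+1}}a_{\vec p,r}\,y_0^{p_0}\cdots y_{M-1}^{p_{M-1}}x^r,\qquad |a_{\vec p,r}|\le\frac{C_a}{b^{|\vec p|}b_2^{r}},$$ for some constants $C_a>0$, $b>4$, $b_2>4$. The maps $J_l$: introduce jet variables $u_{i,k}$, $0\le i\le N-1$, $k\in\mathbb N$ (standing for $\partial_t^i\partial_x^ky$). On smooth functions $G$ of $x\in[-1,1]$ and finitely many jet variables put $D_xG=\partial_xG+\sum_{i,k}u_{i,k+1}\,\partial G/\partial u_{i,k}$ and $D_tG=\sum_{i<N-1,\,k}u_{i+1,k}\,\partial G/\partial u_{i,k}+\sum_k (D_x^kF)\,\partial G/\partial u_{N-1,k}$, where, writing $P=\sum_{j=0}^M\zeta_j\partial_x^j$ (here $\zeta_j=0$ for $j$ odd), $F=\sum_{j=0}^M\zeta_ju_{0,j}+f(x,u_{0,0},\dots,u_{0,M-1})$. Let $J_l=(D_t^lu_{0,0},\dots,D_t^lu_{0,M-1})$.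 It depends only on $x$ and the $u_{i,k}$ with $k\le m(l)$ for some $m(l)\in\mathbb N$, and is a smooth map $[-1,1]\times(\mathbb R^N)^{m(l)+1}\to\mathbb R^M$ (the $k$-th $\mathbb R^N$-argument being $(u_{0,k},\dots,u_{N-1,k})$); it satisfies $\partial_t^lY^x=J_l(x,Y^t,\dots,\partial_x^{m(l)}Y^t)$ for every smooth solution of the PDE. Compatibility set: $\mathcal C=\{Y_0\in C^\infty([0,1])^N:\ BJ_l(x,Y_0,\partial_xY_0,\dots,\partial_x^{m(l)}Y_0)|_{x=0}=0\ \ \forall l\in\mathbb N\}$.
   Formalization: As stated, false: f is arbitrary for y outside (-4,4)^M. In (1) and (2) the equality is proved for Y_0 with (y_0(0),...,∂_x^{M-1}y_0(0)) in (-4,4)^M, and for all Y_0 if the symmetry of f holds for all y in R^M. *)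

(* Defs.v *)
From mathcomp Require Export all_boot all_order all_algebra.
From mathcomp Require Export all_classical all_reals all_analysis.
From mathcomp Require Export summability.

Set Implicit Arguments.
Unset Strict Implicit.
Unset Printing Implicit Defensive.

Export Order.TTheory GRing.Theory Num.Theory.
Export numFieldNormedType.Exports.

#[export] Set Implicit Arguments.
#[export] Unset Strict Implicit.
#[export] Unset Printing Implicit Defensive.

Local Open Scope classical_set_scope.
Local Open Scope ring_scope.

Section CompatibilitySet.
Context {R : realType}.

(* C^oo functions on R^m: all iterated partial derivatives exist and are
   continuous; the partial derivatives are taken from right to left in s. *)
Definition partials m (f : 'rV[R]_m -> R) (s : seq 'I_m) : 'rV[R]_m -> R :=
  foldr (fun i g => 'D_(delta_mx 0 i) g) f s.

Definition smooth m (f : 'rV[R]_m -> R) : Prop :=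
  forall s : seq 'I_m, continuous (partials f s) /\
    forall (i : 'I_m) z, derivable (partials f s) z (delta_mx 0 i).

(* An element of C^oo([0, 1]) is represented by any y : R -> R extending it.
   Derivatives are taken within [0, 1], hence are one-sided at 0 and 1: on
   [0, 1] they do not depend on the extension. *)
Definition quotient01 (y : R -> R) (x z : R) : R := (y z - y x) / (z - x).

Definition deriv01 (y : R -> R) (x : R) : R :=
  lim (quotient01 y x @ within `[0, 1] x^').

Definition derivn01 (k : nat) (y : R -> R) : R -> R := iter k deriv01 y.

Definition smooth01 (y : R -> R) : Prop :=
  forall k (x : R), 0 <= x <= 1 ->
    cvg (quotient01 (derivn01 k y) x @ within `[0, 1] x^').

Definition xrow M (x : R) (y : 'rV[R]_M) : 'rV[R]_M.+1 := row_mx x%:M y.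

Definition cube M : set 'rV[R]_M := [set y | forall i, -4 < y 0 i < 4].

Definition nonlinearity M (f : 'rV[R]_M.+1 -> R) : Prop :=
  [/\ smooth f,
      forall x : R, -4 < x < 4 -> f (xrow x 0) = 0 &
      exists (a : {ffun 'I_M -> nat} * nat -> R) (Ca b b2 : R),
        [/\ 0 < Ca, 4 < b, 4 < b2,
            forall p r, `|a (p, r)| <= Ca / (b ^+ (\sum_i p i)%N * b2 ^+ r) &
            forall (x : R) (y : 'rV[R]_M), -4 < x < 4 -> cube y ->
              partial_sum
                (fun pr => a pr * (\prod_i y 0 i ^+ pr.1 i) * x ^+ pr.2)
                @ totally --> f (xrow x y)]].

(* u i k stands for d_t^i d_x^k y; the time order is N = n.+1. *)
Definition jet n := 'I_n.+1 -> nat -> R.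

Definition setjet n (u : jet n) (i : 'I_n.+1) (k : nat) (s : R) : jet n :=
  fun i' k' => if (i' == i) && (k' == k) then s else u i' k'.

(* For a G that depends on finitely many jet variables the sums in Dx and Dt
   have finite support. *)
Definition dfun n := R -> jet n -> R.

Definition dG_dx n (G : dfun n) : dfun n := fun x u => derive1 (G ^~ u) x.

Definition dG_du n (i : 'I_n.+1) (k : nat) (G : dfun n) : dfun n :=
  fun x u => derive1 (fun s => G x (setjet u i k s)) (u i k).

Definition Dx n (G : dfun n) : dfun n := fun x u =>
  dG_dx G x u +
  \sum_(ik \in [set: 'I_n.+1 * nat]) u ik.1 ik.2.+1 * dG_du ik.1 ik.2 G x u.

Definition Frhs n M (zeta : nat -> R) (f : 'rV[R]_M.+1 -> R) : dfun n :=
  fun x u => \sum_(j < M.+1) zeta j * u ord0 j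
             + f (xrow x (\row_(j < M) u ord0 j)).

Definition Dt n M (zeta : nat -> R) (f : 'rV[R]_M.+1 -> R) (G : dfun n) :
    dfun n := fun x u =>
  \sum_(ik \in [set: 'I_n.+1 * nat])
    (if (ik.1 < n)%N then u (inord ik.1.+1) ik.2
     else iter ik.2 (@Dx n) (Frhs zeta f) x u) * dG_du ik.1 ik.2 G x u.

Definition J n M (zeta : nat -> R) (f : 'rV[R]_M.+1 -> R) (l : nat)
    (x : R) (u : jet n) : 'cV[R]_M :=
  \col_(j < M) iter l (Dt zeta f) (fun _ v => v ord0 j) x u.

Definition jet_of n (Y : 'I_n.+1 -> R -> R) (x : R) : jet n :=
  fun i k => derivn01 k (Y i) x.

Definition smoothY n : set ('I_n.+1 -> R -> R) :=
  [set Y | forall i, smooth01 (Y i)].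

Definition compatible n M q (zeta : nat -> R) (f : 'rV[R]_M.+1 -> R)
    (B : 'M[R]_(q, M)) : set ('I_n.+1 -> R -> R) :=
  [set Y | smoothY Y /\ forall l, B *m J zeta f l 0 (jet_of Y 0) = 0].

(* B Y^x(0, t) = 0 reduces to d_x^j y(0, t) = 0 for all j < M satisfying S. *)
Definition reduces_to M q (B : 'M[R]_(q, M)) (S : pred nat) : Prop :=
  forall v : 'cV[R]_M, B *m v = 0 <-> forall j : 'I_M, S j -> v j 0 = 0.

Definition odd_symmetry M (f : 'rV[R]_M.+1 -> R) (V : set 'rV[R]_M) : Prop :=
  forall (x : R) (y : 'rV[R]_M), -1 <= x <= 1 -> V y ->
    f (xrow (- x) (\row_(i < M) ((-1) ^+ i.+1 * y 0 i))) = - f (xrow x y).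

Definition even_symmetry M (f : 'rV[R]_M.+1 -> R) (V : set 'rV[R]_M) : Prop :=
  forall (x : R) (y : 'rV[R]_M), -1 <= x <= 1 -> V y ->
    f (xrow (- x) (\row_(i < M) ((-1) ^+ i * y 0 i))) = f (xrow x y).

Definition vanishing n (S : pred nat) : set ('I_n.+1 -> R -> R) :=
  [set Y | smoothY Y /\ forall k, S k -> forall i, derivn01 k (Y i) 0 = 0].

(* The value at x = 0 of the arguments (y_0, ..., d_x^(M-1) y_0) of f lies in
   V. A symmetry of f on V alone says nothing about the other Y: for M = 2,
   N = 1, P = d_x^2 and f a smooth function of y_1 that vanishes on ]-4, 4[
   and equals 1 at 10, the datum Y = 10 x satisfies the Dirichlet condition
   and has vanishing even derivatives, but D_t u_(0,0) = 1 at x = 0. *)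
Definition trace_in n M (V : set 'rV[R]_M) : set ('I_n.+1 -> R -> R) :=
  [set Y | V (\row_(k < M) derivn01 k (Y ord0) 0)].

End CompatibilitySet.

(* Main.v *)
Require Import Defs.
From mathcomp Require Import zify.
Local Open Scope classical_set_scope.
Local Open Scope ring_scope.

(** Reflect [x] to [- x] and multiply the jet variable [u i k] by
[(-1) ^+ (k + e)], where [e] is 1 under the odd symmetry and 0 under the even
one.  The total derivative [Dx] reverses the parity of a function under this
reflection and, the symmetry of [f] and the evenness of [P] giving the
right-hand side [F] the parity [e], the evolution derivative [Dt] preserves it
([parity_Dx], [parity_Dt]).  Hence [Dt ^ l u_(0, j)] has parity [j + e].  A
function of odd parity vanishes at a fixed point of the reflection
([parity_fixed]), and the jets at [x = 0] whose entries of odd [k + e] vanish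
are exactly the fixed points there: this gives one inclusion.

For the converse, give [u i k] the weight [k * N + i * M].  The operator [Dx]
raises weights by [N] and [Dt] raises them by [M], and
[Dt ^ (a * N + i) u_(0, j)] is [zeta M ^+ a * u i (j + a * M)] plus a function
of the variables of smaller weight ([leads_iter_Dt]).  As [M] is even,
[j + a * M] has the parity of [j].  So the entries of odd [k + e] are shown to
vanish by induction on the weight ([vanishing_jetP]): once they vanish below a
given weight, the jet truncated at this weight is a fixed point, where
[Dt ^ l u_(0, j)] vanishes for reasons of parity.  Comparing with the value 0
at the jet itself, only the term [zeta M ^+ a * u i (j + a * M)] remains.

Two rules carry all the differentiations of general functions: a derivative
commutes with sign changes, and it ignores additive constants
([derive1_sign], [derive1_shift]).  Both hold for every function, because a
difference quotient without limit gives the derivative 0 by convention.  This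
is why the leading variable is split off as a summand. *)

(** * Derivatives under sign changes *)

Lemma signMK (R : pzRingType) (a : nat) (x : R) :
  (-1) ^+ a * ((-1) ^+ a * x) = x.
Proof. by rewrite mulrA -expr2 sqrr_sign mul1r. Qed.

Section SignedDerivative.
Context {R : realType}.
Implicit Types (g h : R -> R) (a b : nat) (t : R).

Lemma sign_dnbhs0 a (A : set R) : 0^' A -> 0^' [set s | A ((-1) ^+ a * s)].
Proof.
rewrite -signr_odd; case: (odd a) => [|]; last first.
  by apply: filterS => s As /=; rewrite mul1r.
move=> A0; have : (- 0)^' A by rewrite oppr0.
rewrite dnbhsN => -[B B0 <-].
by apply: filterS B0 => s Bs /=; rewrite expr1 mulN1r; exists s.
Qed.

Lemma sign_nbhs a t (A : set R) :
  nbhs t A -> nbhs ((-1) ^+ a * t) [set s | A ((-1) ^+ a * s)].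
Proof.
rewrite -signr_odd; case: (odd a) => [|]; last first.
  by rewrite mul1r; apply: filterS => s As /=; rewrite mul1r.
by rewrite expr1 mulN1r nbhsN; apply: filterS => s As /=; rewrite mulN1r opprK.
Qed.

Lemma cvg_quotient_sign a b g h t l :
  (\forall s \near t, g ((-1) ^+ a * s) = (-1) ^+ b * h s) ->
  e^-1 *: (g (e + (-1) ^+ a * t) - g ((-1) ^+ a * t)) @[e --> 0^'] --> l ->
  e^-1 *: (h (e + t) - h t) @[e --> 0^'] --> (-1) ^+ (a + b) * l.
Proof.
move=> gh gl.
have gl' : ((-1) ^+ a * e)^-1 *: (g ((-1) ^+ a * e + (-1) ^+ a * t)
             - g ((-1) ^+ a * t)) @[e --> 0^'] --> l.
  by move=> A /gl /(sign_dnbhs0 a).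
apply: (cvg_trans _ (cvgZl_tmp (k := (-1) ^+ (a + b)) gl')).
apply: near_eq_cvg.
have ght := nbhs_singleton gh.
have : \forall e \near 0, g ((-1) ^+ a * (e + t)) = (-1) ^+ b * h (e + t).
  have : (e + t) @[e --> 0] --> t.
    rewrite -[X in _ --> X]add0r; apply: cvgD; [exact: cvg_id|exact: cvg_cst].
  by move=> /(_ _ gh).
move=> /(@nbhs_dnbhs _ _ _); apply: filterS => e Ee.
have signE (x : R) :
    (-1) ^+ (a + b) * ((-1) ^+ a / e * ((-1) ^+ b * x)) = e^-1 * x.
  by rewrite [in LHS]mulrACA -exprD signMK.
by rewrite /= -mulrDr Ee ght -mulrBr invr_signM; exact: signE.
Qed.

(** The relation between [g] and [h] is symmetric, so their difference quotients
converge together; when they diverge both derivatives are 0. *)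
Lemma derive1_sign a b g h t :
  (\forall s \near t, g ((-1) ^+ a * s) = (-1) ^+ b * h s) ->
  derive1 g ((-1) ^+ a * t) = (-1) ^+ (a + b) * derive1 h t.
Proof.
move=> gh.
have hg : \forall s \near ((-1) ^+ a * t), h ((-1) ^+ a * s) = (-1) ^+ b * g s.
  apply: filterS (sign_nbhs a gh) => s /=; rewrite signMK => ->.
  by rewrite signMK.
rewrite /derive1.
have [cvg_h|dvg_h] := pselect (cvg (e^-1 *: (h (e + t) - h t) @[e --> 0^'])).
  apply: cvg_lim => //; apply: (@cvg_quotient_sign a b h g _ _ hg).
  by rewrite signMK.
have dvg_g : ~ cvg (e^-1 *: (g (e + (-1) ^+ a * t) - g ((-1) ^+ a * t))
                      @[e --> 0^']).
  move=> /(cvg_quotient_sign gh) cvg_h; apply: dvg_h.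
  by apply/cvg_ex; eexists; exact: cvg_h.
by rewrite (dvgP dvg_g) (dvgP dvg_h) mulr0.
Qed.

Lemma derive1_shift g t k : derive1 (fun s => g s + k) t = derive1 g t.
Proof.
rewrite /derive1 (_ : (fun e => _) = (fun e => e^-1 *: (g (e + t) - g t)))//.
by apply/funext => e; rewrite opprD addrACA subrr addr0.
Qed.

Lemma derive1_affine (c k t : R) : derive1 (fun s => c * s + k) t = c.
Proof.
rewrite (derive1_shift (fun s => c * s)) derive1Ml ?derive1_id ?mulr1//.
Qed.

End SignedDerivative.

(** * Weights of jet variables and leading variables *)

Section Jets.
Context {R : realType} {n M : nat}.
Implicit Types (G H : @dfun R n) (u v : @jet R n) (x c s : R) (w : nat).
Implicit Types (T : 'I_n.+1 * nat -> @dfun R n).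

(** The weight for which the equation is homogeneous: [M] space derivatives cost
as much as the [N = n.+1] time derivatives that they replace. *)
Definition weight (i : 'I_n.+1) (k : nat) : nat := k * n.+1 + i * M.

Definition below w G : Prop := forall x u v,
  (forall i k, (weight i k < w)%N -> u i k = v i k) -> G x u = G x v.

Definition remainder c i0 k0 G : @dfun R n := fun x u => G x u - c * u i0 k0.

(** [c * u i0 k0] is the only contribution of weight at least that of [u i0 k0];
no other variable of the same weight occurs. *)
Definition leads c i0 k0 G : Prop :=
  below (weight i0 k0) (remainder c i0 k0 G).

Lemma leq_weight i k : (k <= weight i k)%N.
Proof. by rewrite (leq_trans (leq_pmulr k (ltn0Sn n)))// leq_addr. Qed.

Lemma weightS i k : weight i k.+1 = (weight i k + n.+1)%N.
Proof. by rewrite /weight mulSn; lia. Qed.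

Lemma below_leq w w' G : (w <= w')%N -> below w G -> below w' G.
Proof.
by move=> ww' Gw x u v uv; apply: Gw => i k /leq_trans ikw; apply/uv/ikw.
Qed.

Lemma below_jet i k : below (weight i k).+1 (fun _ u => u i k).
Proof. by move=> x u v; apply. Qed.

Lemma leads_jet i k : leads 1 i k (fun _ u => u i k).
Proof. by move=> x u v _; rewrite /remainder !mul1r !subrr. Qed.

Lemma leads_below c i k G : leads c i k G -> below (weight i k).+1 G.
Proof.
move=> Gik x u v uv.
have uv_lt i' k' : (weight i' k' < weight i k)%N -> u i' k' = v i' k'.
  by move=> lt; apply: uv; exact: ltnW.
by have := Gik x u v uv_lt; rewrite /remainder (uv i k)// => /addIr.
Qed.

Lemma setjet_below w i k u v s :
  (forall i k, (weight i k < w)%N -> u i k = v i k) ->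
  forall i' k', (weight i' k' < w)%N ->
    setjet u i k s i' k' = setjet v i k s i' k'.
Proof. by move=> uv i' k' lt; rewrite /setjet; case: ifP => // _; apply: uv. Qed.

Lemma below_setjet w G i k x u s : below w G -> (w <= weight i k)%N ->
  G x (setjet u i k s) = G x u.
Proof.
move=> Gw wik; apply: Gw => i' k' lt; rewrite /setjet.
by case: ifP => // /andP[/eqP ii /eqP kk]; move: lt; rewrite ii kk ltnNge wik.
Qed.

Lemma dG_du_high w G i k x u : below w G -> (w <= weight i k)%N ->
  dG_du i k G x u = 0.
Proof.
move=> Gw wik; rewrite /dG_du -[RHS](derive1_cst (G x u) (u i k)); congr derive1.
by apply/funext => s; rewrite (below_setjet _ _ _ Gw).
Qed.

Lemma below_dG_dx w G : below w G -> below w (dG_dx G).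
Proof.
move=> Gw x u v uv; rewrite /dG_dx; congr derive1.
by apply/funext => y; apply: Gw.
Qed.

Lemma below_dG_du w i k G : below w G -> below w (dG_du i k G).
Proof.
move=> Gw x u v uv; have [wik|ikw] := leqP w (weight i k).
  by rewrite !(dG_du_high _ _ Gw).
rewrite /dG_du (uv _ _ ikw); congr derive1.
by apply/funext => s; apply: Gw; apply: setjet_below.
Qed.

Lemma dG_dx_remainder c i0 k0 G x u :
  dG_dx G x u = dG_dx (remainder c i0 k0 G) x u.
Proof. by rewrite /dG_dx derive1_shift. Qed.

(** [G] is affine in its leading variable, while for the other variables the
leading term is an additive constant. *)
Lemma dG_du_leads c i0 k0 G i k x u : leads c i0 k0 G ->
  dG_du i k G x u = dG_du i k (remainder c i0 k0 G) x u
                    + c * ((i == i0) && (k == k0))%:R.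
Proof.
move=> Gl; case: (boolP (_ && _)) => [/andP[/eqP -> /eqP ->]|ik].
  rewrite (dG_du_high _ _ Gl)// add0r mulr1 /dG_du.
  rewrite -[RHS](derive1_affine c (remainder c i0 k0 G x u) (u i0 k0)).
  congr derive1; apply/funext => s.
  rewrite -(below_setjet x u s Gl (leqnn _)) /remainder /setjet !eqxx /=.
  by rewrite addrC subrK.
rewrite mulr0 addr0 /dG_du -(derive1_shift _ (u i k) (- (c * u i0 k0))).
congr derive1; apply/funext => s; rewrite /remainder /setjet.
by rewrite (eq_sym i0) (eq_sym k0) (negbTE ik).
Qed.

(** The common shape of [Dx], up to [dG_dx], and of [Dt]: the action on [G] of a
vector field on the space of jets. *)
Definition vfield T G : @dfun R n := fun x u =>
  \sum_(ik \in [set: 'I_n.+1 * nat]) T ik x u * dG_du ik.1 ik.2 G x u.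

Lemma vfieldE T w K G x u : below w G -> (w <= K)%N ->
  vfield T G x u =
  \sum_(i < n.+1) \sum_(k < K) T (i, nat_of_ord k) x u * dG_du i k G x u.
Proof.
move=> Gw wK.
rewrite /vfield (fsbigE [seq (i, k) | i <- enum 'I_n.+1, k <- iota 0 K])//.
- under eq_bigl do rewrite in_setT.
  rewrite big_allpairs big_enum; apply: eq_bigr => i _.
  by rewrite -[K in LHS]subn0 big_mkord.
- by rewrite allpairs_uniq ?enum_uniq ?iota_uniq// => -[? ?] [? ?].
- move=> [i k] _ nik; rewrite /= (dG_du_high _ _ Gw) ?mulr0//.
  apply: (leq_trans wK); apply: (leq_trans _ (leq_weight i k)).
  rewrite leqNgt; apply: contra nik => kK.
  by apply/allpairsP; exists (i, k); rewrite mem_enum mem_iota.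
Qed.

Lemma below_vfield w w' T G : below w G -> (w <= w')%N ->
  (forall i k, (weight i k < w)%N -> below w' (T (i, k))) ->
  below w' (vfield T G).
Proof.
move=> Gw ww' Tw' x u v uv; rewrite !(vfieldE T _ _ Gw (leqnn w)).
apply: eq_bigr => i _; apply: eq_bigr => k _.
have [wik|ikw] := leqP w (weight i k).
  by rewrite !(dG_du_high _ _ Gw)// !mulr0.
by congr (_ * _); [exact: Tw'|exact: (below_leq ww' (below_dG_du i k Gw))].
Qed.

Lemma vfield_leads T c i0 k0 G x u : leads c i0 k0 G ->
  vfield T G x u = vfield T (remainder c i0 k0 G) x u + c * T (i0, k0) x u.
Proof.
move=> Gl; set K := (weight i0 k0).+1.
rewrite (vfieldE T _ _ (leads_below Gl) (leqnn K)) (vfieldE T _ _ Gl (leqnSn _)).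
rewrite -/K; under eq_bigr do under eq_bigr do
  rewrite (dG_du_leads _ _ _ _ Gl) mulrDr.
under eq_bigr do rewrite big_split/=.
rewrite big_split/=; congr (_ + _).
have k0K : (k0 < K)%N by rewrite ltnS leq_weight.
rewrite (bigD1 i0)//= (bigD1 (Ordinal k0K))//= !eqxx mulr1 !big1 ?addr0 1?mulrC//.
  by move=> i /negbTE ii0; rewrite big1// => k _; rewrite ii0 !mulr0.
move=> k kk0; rewrite (_ : (k == k0 :> nat) = false) ?mulr0//.
by apply/negbTE; apply: contra kk0 => /eqP kk0; apply/eqP/val_inj.
Qed.

Definition Dx_coef (ik : 'I_n.+1 * nat) : @dfun R n :=
  fun _ u => u ik.1 ik.2.+1.

Lemma below_Dx_coef i k : below (weight i k.+1).+1 (Dx_coef (i, k)).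
Proof. by move=> x u v; exact. Qed.

Lemma DxE G x u : Dx G x u = dG_dx G x u + vfield Dx_coef G x u.
Proof. by []. Qed.

Lemma below_Dx w G : below w G -> below (w + n.+1) (Dx G).
Proof.
move=> Gw x u v uv; rewrite !DxE; congr (_ + _).
  exact: (below_leq (leq_addr n.+1 w) (below_dG_dx Gw)).
apply: (@below_vfield w _ Dx_coef _ Gw (leq_addr n.+1 w) _ x u v uv) => i k ikw.
apply: (below_leq _ (@below_Dx_coef i k)).
by rewrite weightS -addSn leq_add2r.
Qed.

Lemma leads_Dx c i k G : leads c i k G -> leads c i k.+1 (Dx G).
Proof.
move=> Gl; rewrite /leads weightS.
rewrite (_ : remainder _ _ _ _ = Dx (remainder c i k G)).
  exact: below_Dx.
apply/funext => x; apply/funext => u; rewrite {1}/remainder !DxE.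
by rewrite (vfield_leads Dx_coef x u Gl) (dG_dx_remainder c i k) addrA addrK.
Qed.

(** * The evolution derivative and its leading variables *)

Section Flow.
Context (zeta : nat -> R) (f : 'rV[R]_M.+1 -> R).
Let F : @dfun R n := Frhs zeta f.

Definition Dt_coef (ik : 'I_n.+1 * nat) : @dfun R n := fun x u =>
  if (ik.1 < n)%N then u (inord ik.1.+1) ik.2 else iter ik.2 (@Dx R n) F x u.

Lemma leads_F : (0 < M)%N -> leads (zeta M) ord0 M F.
Proof.
move=> M0 x u v uv; rewrite /remainder /F /Frhs !big_ord_recr /=.
have uvj (j : 'I_M) : u ord0 j = v ord0 j.
  by apply: uv; rewrite /weight !mul0n !addn0 ltn_mul2r/=.
rewrite addrAC addrK [in RHS]addrAC addrK; congr (_ + _).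
  by apply: eq_bigr => j _; rewrite uvj.
by congr (f (xrow _ _)); apply/rowP => j; rewrite !mxE uvj.
Qed.

Context (M_gt0 : (0 < M)%N).

Lemma leads_DxF k : leads (zeta M) ord0 (k + M) (iter k (@Dx R n) F).
Proof.
by elim: k => [|k IHk]; [exact: leads_F|rewrite addSn; exact: leads_Dx].
Qed.

Lemma weight_inord (i : 'I_n.+1) k : (i < n)%N ->
  weight (inord i.+1) k = (weight i k + M)%N.
Proof. by move=> i_lt; rewrite /weight inordK// mulSn; lia. Qed.

Lemma weight_max (i : 'I_n.+1) k : ~~ (i < n)%N ->
  weight ord0 (k + M) = (weight i k + M)%N.
Proof.
rewrite -leqNgt => n_le; have i_n : i = n :> nat.
  by apply/eqP; rewrite eqn_leq n_le -ltnS ltn_ord.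
by rewrite /weight i_n mul0n addn0 mulnDl mulnS; lia.
Qed.

Lemma DtE G : Dt zeta f G = vfield Dt_coef G.
Proof. by []. Qed.

Lemma below_Dt_coef i k : below (weight i k + M).+1 (Dt_coef (i, k)).
Proof.
move=> x u v uv; rewrite /Dt_coef /=; case: ifPn => i_n.
  by apply: uv; rewrite weight_inord.
by apply: (leads_below (@leads_DxF k)); rewrite (@weight_max i k i_n).
Qed.

Lemma below_Dt w G : below w G -> below (w + M) (Dt zeta f G).
Proof.
move=> Gw; rewrite DtE; apply: (below_vfield Gw (leq_addr M w)) => i k ikw.
by apply: (below_leq _ (@below_Dt_coef i k)); rewrite -addSn leq_add2r.
Qed.

Lemma Dt_leads c i k G x u : leads c i k G ->
  Dt zeta f G x u = Dt zeta f (remainder c i k G) x u + c * Dt_coef (i, k) x u.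
Proof. by rewrite !DtE; exact: vfield_leads. Qed.

Lemma leads_Dt_lt c (i : 'I_n.+1) k G : (i < n)%N -> leads c i k G ->
  leads c (inord i.+1) k (Dt zeta f G).
Proof.
move=> i_n Gl; rewrite /leads weight_inord//.
rewrite (_ : remainder _ _ _ _ = Dt zeta f (remainder c i k G)).
  exact: below_Dt.
apply/funext => x; apply/funext => u.
by rewrite {1}/remainder (Dt_leads _ _ Gl) /Dt_coef/= i_n addrK.
Qed.

(** The last time derivative [u n k] evolves by the equation, whose leading term
trades [N] time derivatives for [M] space derivatives. *)
Lemma leads_Dt_max c (i : 'I_n.+1) k G : ~~ (i < n)%N -> leads c i k G ->
  leads (c * zeta M) ord0 (k + M) (Dt zeta f G).
Proof.
move=> i_n Gl x u v uv; rewrite /remainder !(Dt_leads _ _ Gl).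
rewrite -!addrA; congr (_ + _).
  by apply: (below_Dt Gl) => i' k' lt; apply: uv; rewrite (@weight_max i k i_n).
rewrite /Dt_coef/= (negbTE i_n) -!mulrA -!mulrBr; congr (_ * _).
exact: (@leads_DxF k).
Qed.

(** The leading variable climbs through the [N] time derivatives of one space
derivative, then restarts [M] space derivatives further; so it reaches every
[u i k]. *)
Lemma leads_iter_Dt (a i j : nat) : (i <= n)%N ->
  leads (zeta M ^+ a) (inord i) (j + a * M)
    (iter (a * n.+1 + i) (Dt zeta f) (fun _ v => v ord0 j)).
Proof.
elim: a i => [|a IHa] i; last first.
  elim: i => [_|i IHi i_n].
    rewrite (_ : _ + 0 = (a * n.+1 + n).+1)%N; last by rewrite mulSn; lia.
    rewrite (_ : j + _ = j + a * M + M)%N; last by rewrite mulSn; lia.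
    rewrite iterS exprSr.
    rewrite (_ : inord 0 = ord0); last by apply/val_inj; rewrite /= inordK.
    by apply: (leads_Dt_max _ (IHa n (leqnn n))); rewrite inordK// ltnn.
  rewrite addnS iterS; have /leads_Dt_lt := IHi (ltnW i_n).
  by rewrite (@inordK n i (ltnW i_n)) => /(_ i_n).
elim: i => [_|i IHi i_n].
  rewrite !mul0n !addn0 expr0 (_ : inord 0 = ord0); first exact: leads_jet.
  by apply/val_inj; rewrite /= inordK.
rewrite addnS iterS; have /leads_Dt_lt := IHi (ltnW i_n).
by rewrite (@inordK n i (ltnW i_n)) => /(_ i_n).
Qed.

Lemma below_iter_Dt l j : exists w,
  below w (iter l (Dt zeta f) (fun _ v => v ord0 j)).
Proof.
elim: l => [|l [w IHl]]; first by exists (weight ord0 j).+1; exact: below_jet.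
by exists (w + M)%N; exact: below_Dt.
Qed.

(** * Parity under the reflection *)

Context (I : set R) (e : nat) (I_open : open I) (I0 : I 0).

(** Where the symmetry of [f] is available: [I] is the interval from -4 to 4 or
the whole line.  Openness lets the parity of [G] on [dom] pass to the
derivatives of [G]. *)
Definition dom x u : Prop := -1 < x < 1 /\ forall k, (k < M)%N -> I (u ord0 k).

Definition flip u : @jet R n := fun i k => (-1) ^+ (k + e) * u i k.

Definition parity (p : nat) G : Prop := forall x u, dom x u ->
  G (- x) (flip u) = (-1) ^+ p * G x u.

Lemma setjet_flip u i k s :
  setjet (flip u) i k ((-1) ^+ (k + e) * s) = flip (setjet u i k s).
Proof.
apply/funext => i'; apply/funext => k'; rewrite /setjet /flip.
by case: ifP => // /andP[_ /eqP ->].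
Qed.

Lemma near_dom_x x u : dom x u -> \forall y \near x, dom y u.
Proof.
move=> [/andP[x1 x2] uI]; near=> y; split=> //; apply/andP; split.
  by near: y; exact: lt_nbhsr.
by near: y; exact: lt_nbhsl.
Unshelve. all: by end_near. Qed.

Lemma near_dom_u x u i k : dom x u ->
  \forall s \near u i k, dom x (setjet u i k s).
Proof.
move=> [x1 uI].
have [/andP[/eqP i0 kM]|ik] := boolP ((i == ord0) && (k < M)%N).
  have : nbhs (u i k) I.
    by apply: open_nbhs_nbhs; split; rewrite ?i0//; exact: uI.
  apply: filterS => s Is; split=> // k' k'M; rewrite /setjet.
  by case: ifP => // _; exact: uI.
near=> s; split=> // k' k'M; rewrite /setjet.
case: ifP => [/andP[/eqP i0 /eqP kk]|_]; last exact: uI.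
by move: ik; rewrite -i0 -kk eqxx k'M.
Unshelve. all: by end_near. Qed.

Lemma parity_dG_dx p G : parity p G -> parity p.+1 (dG_dx G).
Proof.
move=> Gp x u xu.
have := @derive1_sign _ 1 p (G ^~ (flip u)) (G ^~ u) x.
rewrite expr1 mulN1r; apply.
by apply: filterS (near_dom_x xu) => y yu; rewrite mulN1r Gp.
Qed.

Lemma parity_dG_du p i k G : parity p G -> parity (k + e + p) (dG_du i k G).
Proof.
move=> Gp x u xu; rewrite /dG_du; apply: derive1_sign.
by apply: filterS (near_dom_u i k xu) => s su; rewrite setjet_flip Gp.
Qed.

(** The sign of the coefficient of [u i k], up to [(-1) ^+ q], cancels the sign
[(-1) ^+ (k + e)] that differentiating in [u i k] produces. *)
Lemma parity_vfield w p q T G : below w G -> parity p G ->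
  (forall i k, parity (q + (k + e)) (T (i, k))) -> parity (q + p) (vfield T G).
Proof.
move=> Gw Gp Tp x u xu; rewrite !(vfieldE T _ _ Gw (leqnn w)).
rewrite mulr_sumr; apply: eq_bigr => i _.
rewrite mulr_sumr; apply: eq_bigr => k _.
rewrite (Tp i k _ _ xu) (parity_dG_du i k Gp xu) mulrACA -exprD.
rewrite (_ : q + (k + e) + _ = (k + e) + ((k + e) + (q + p)))%N; last by lia.
by rewrite (exprD _ (k + e)) (exprD _ (k + e) (q + p)) signMK.
Qed.

Lemma parity_Dx w p G : below w G -> parity p G -> parity p.+1 (Dx G).
Proof.
move=> Gw Gp x u xu; rewrite !DxE mulrDr (parity_dG_dx Gp xu); congr (_ + _).
apply: (@parity_vfield w p 1 Dx_coef _ Gw Gp _ x u xu).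
by [].
Qed.

Context (zeta_odd : forall j, odd j -> zeta j = 0).
Context (f_sym : forall x (y : 'rV[R]_M), -1 <= x <= 1 ->
  (forall i, I (y 0 i)) ->
  f (xrow (- x) (\row_(i < M) ((-1) ^+ (i + e) * y 0 i)))
  = (-1) ^+ e * f (xrow x y)).

Lemma parity_F : parity e F.
Proof.
move=> x u [/andP[x1 x2] uI]; rewrite /F /Frhs mulrDr; congr (_ + _).
  rewrite mulr_sumr; apply: eq_bigr => j _; rewrite /flip.
  have [/zeta_odd ->|/negbTE jeven] := boolP (odd j).
    by rewrite !mul0r mulr0.
  by rewrite exprD -signr_odd jeven mul1r mulrCA.
rewrite -f_sym ?ltW//; last by move=> i; rewrite mxE; exact: uI.
by congr (f (xrow _ _)); apply/rowP => j; rewrite !mxE.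
Qed.

Lemma parity_DxF k : parity (k + e) (iter k (@Dx R n) F).
Proof.
elim: k => [|k IHk]; first exact: parity_F.
exact: parity_Dx (leads_below (@leads_DxF k)) IHk.
Qed.

Lemma parity_Dt w p G : below w G -> parity p G -> parity p (Dt zeta f G).
Proof.
move=> Gw Gp; rewrite DtE; apply: (@parity_vfield w p 0 _ _ Gw Gp) => i k x u xu.
rewrite /Dt_coef /=; case: ifP => // _; exact: parity_DxF.
Qed.

Lemma parity_iter_Dt l j :
  parity (j + e) (iter l (Dt zeta f) (fun _ v => v ord0 j)).
Proof.
elim: l => [//|l IHl]; have [w Gw] := below_iter_Dt l j.
exact: parity_Dt Gw IHl.
Qed.

Lemma parity_fixed p G u : parity p G -> odd p -> dom 0 u ->
  (forall i k, odd (k + e) -> u i k = 0) -> G 0 u = 0.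
Proof.
move=> Gp p_odd u0 ufix; have := Gp _ _ u0.
have -> : flip u = u.
  apply/funext => i; apply/funext => k; rewrite /flip.
  rewrite -signr_odd; case: (boolP (odd _)) => [/ufix ->|_]; rewrite ?mulr0//.
  by rewrite mul1r.
by rewrite oppr0 -signr_odd p_odd mulN1r => /esym/eqP; rewrite eqNr => /eqP.
Qed.

Context (M_even : ~~ odd M) (zetaM : zeta M != 0).

(** Induction on the weight: the equation [Dt ^ l u_(0, j) = 0] with
[l = a * N + i] and [k = j + a * M] is what forces [u i k = 0]. *)
Lemma vanishing_jetP u : dom 0 u ->
  (forall l j, (j < M)%N -> odd (j + e) ->
     iter l (Dt zeta f) (fun _ v => v ord0 j) 0 u = 0) <->
  (forall i k, odd (k + e) -> u i k = 0).
Proof.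
move=> u0; split=> [Du|ufix l j jM jodd]; last first.
  exact: (parity_fixed (@parity_iter_Dt l j)).
suff H w : forall i k, weight i k = w -> odd (k + e) -> u i k = 0.
  by move=> i k; exact: H.
elim/ltn_ind: w => w IHw i k ikw kodd.
pose a := (k %/ M)%N; pose j := (k %% M)%N.
have kE : k = (j + a * M)%N by rewrite addnC -divn_eq.
have jM : (j < M)%N by rewrite ltn_mod.
have jodd : odd (j + e).
  by move: kodd; rewrite {1}kE !oddD oddM (negbTE M_even) andbF addbF.
pose l := (a * n.+1 + i)%N.
pose G : @dfun R n := iter l (Dt zeta f) (fun _ v => v ord0 j).
have Gl : leads (zeta M ^+ a) i k G.
  have := @leads_iter_Dt a i j; rewrite -kE inord_val; apply.
  by rewrite -ltnS ltn_ord.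
(* By induction this truncation of [u] is fixed by the reflection; it stays in
   the domain because [I] contains 0. *)
pose u' : @jet R n := fun i' k' => if (weight i' k' < w)%N then u i' k' else 0.
have u'0 : dom 0 u'.
  split; first by case: u0.
  by move=> k' k'M; rewrite /u'; case: ifP => // _; case: u0 => _; apply.
have Gu' : G 0 u' = 0.
  apply: (parity_fixed (@parity_iter_Dt l j)) => // i' k' k'odd.
  by rewrite /u'; case: ifP => // lt; exact: IHw lt _ _ erefl k'odd.
have := Gl 0 u u'; rewrite /remainder Gu' /G (Du l j jM jodd) ikw {2}/u' ikw ltnn.
rewrite mulr0 subr0 sub0r => /(_ _)/eqP; rewrite oppr_eq0 mulf_eq0 expf_eq0.
rewrite (negbTE zetaM) andbF /= => H; apply/eqP/H => i' k' lt.
by rewrite /u' lt.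
Qed.

End Flow.
End Jets.

(** * The compatibility set *)

Section Compatibility.
Context {R : realType} {M n q : nat}.
Context (zeta : nat -> R) (f : 'rV[R]_M.+1 -> R) (B : 'M[R]_(q, M)).
Context (I : set R) (e : nat).

Let V : set 'rV[R]_M := [set y | forall i, I (y 0 i)].

(** Both cases at once, with [e = 1] for the odd symmetry and [e = 0] for the even
one: the boundary conditions annihilate the components of [J] of odd parity,
which brings the claim down to the jet of [Y] at 0. *)
Lemma compatible_eq_vanishing :
  (0 < M)%N -> ~~ odd M -> (forall j, odd j -> zeta j = 0) -> zeta M != 0 ->
  open I -> I 0 ->
  (forall x (y : 'rV[R]_M), -1 <= x <= 1 -> V y ->
    f (xrow (- x) (\row_(i < M) ((-1) ^+ (i + e) * y 0 i)))
    = (-1) ^+ e * f (xrow x y)) ->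
  reduces_to B (fun j => odd (j + e)) ->
  @compatible R n M q zeta f B `&` trace_in V
  = vanishing (fun k => odd (k + e)) `&` trace_in V.
Proof.
move=> M_gt0 M_even zeta_odd zetaM I_open I0 f_sym BS.
have jetP (Y : 'I_n.+1 -> R -> R) : trace_in V Y ->
    (forall l, B *m J zeta f l 0 (jet_of Y 0) = 0) <->
    (forall k, odd (k + e) -> forall i, derivn01 k (Y i) 0 = 0).
  move=> YV; have Y0 : @dom R n M I 0 (jet_of Y 0).
    split=> [|k kM]; first by rewrite ltrN10 ltr01.
    by have := YV (Ordinal kM); rewrite mxE.
  have := vanishing_jetP M_gt0 I_open I0 zeta_odd f_sym M_even zetaM Y0.
  move=> [DY YD]; split=> [BY k kodd i|Yvan l].
    apply: (DY _ i k kodd) => l j jM jodd.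
    by have /BS/(_ (Ordinal jM) jodd) := BY l; rewrite mxE.
  by apply/BS => j jodd; rewrite mxE; apply: YD => // i k /Yvan; apply.
by apply/seteqP; split=> Y [[Ysm YC] YV]; split=> //; split=> //;
  apply/(jetP _ YV).
Qed.

End Compatibility.

Theorem proposition1p3 (R : realType) (M n q : nat) (zeta : nat -> R)
    (f : 'rV[R]_M.+1 -> R) (B : 'M[R]_(q, M)) :
  (0 < M)%N -> (n.+1 < M)%N -> ~~ odd M ->
  (forall j, odd j -> zeta j = 0) -> zeta M != 0 ->
  nonlinearity f ->
  (reduces_to B (fun j => ~~ odd j) ->
     (odd_symmetry f (@cube R M) ->
        @compatible R n M q zeta f B `&` trace_in (@cube R M)
        = vanishing (fun k => ~~ odd k) `&` trace_in (@cube R M)) /\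
     (odd_symmetry f setT ->
        @compatible R n M q zeta f B = vanishing (fun k => ~~ odd k))) /\
  (reduces_to B odd ->
     (even_symmetry f (@cube R M) ->
        @compatible R n M q zeta f B `&` trace_in (@cube R M)
        = vanishing odd `&` trace_in (@cube R M)) /\
     (even_symmetry f setT ->
        @compatible R n M q zeta f B = vanishing odd)).

Proof.
move=> M_gt0 _ M_even zeta_odd zetaM _.
have evenE : (fun k => ~~ odd k) = (fun k => odd (k + 1)).
  by apply/funext => k; rewrite addn1.
have oddE : odd = (fun k => odd (k + 0)).
  by apply/funext => k; rewrite addn0.
have cubeE : @cube R M = [set y | forall i, `]-4, 4[%classic (y 0 i)].
  by apply/seteqP; split=> y y4 i; have := y4 i; rewrite /= in_itv.
have setTE : [set: 'rV[R]_M] = [set y | forall i, [set: R] (y 0 i)].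
  by apply/seteqP; split.
have traceT : @trace_in R n M setT = setT by apply/seteqP; split.
have I4 : `]-4, 4[%classic (0 : R) by rewrite /= in_itv /= oppr_lt0 ltr0n.
have odd_sym V : odd_symmetry f V ->
    forall x (y : 'rV[R]_M), -1 <= x <= 1 -> V y ->
    f (xrow (- x) (\row_(i < M) ((-1) ^+ (i + 1) * y 0 i)))
    = (-1) ^+ 1 * f (xrow x y).
  move=> fV x y x1 Vy; rewrite expr1 mulN1r -fV//; congr (f (xrow _ _)).
  by apply/rowP => i; rewrite !mxE addn1.
have even_sym V : even_symmetry f V ->
    forall x (y : 'rV[R]_M), -1 <= x <= 1 -> V y ->
    f (xrow (- x) (\row_(i < M) ((-1) ^+ (i + 0) * y 0 i)))
    = (-1) ^+ 0 * f (xrow x y).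
  move=> fV x y x1 Vy; rewrite expr0 mul1r -[RHS]fV//; congr (f (xrow _ _)).
  by apply/rowP => i; rewrite !mxE addn0.
split=> [|].
  rewrite evenE => BS; split=> [/odd_sym|/odd_sym].
    rewrite cubeE => f_sym.
    exact: (compatible_eq_vanishing M_gt0 M_even zeta_odd zetaM _ I4 f_sym BS).
  rewrite -[LHS]setIT -[RHS]setIT -traceT setTE => f_sym.
  exact: (compatible_eq_vanishing M_gt0 M_even zeta_odd zetaM openT _ f_sym BS).
rewrite [in reduces_to _ _]oddE [in vanishing _]oddE => BS.
split=> [/even_sym|/even_sym].
  rewrite cubeE => f_sym.
  exact: (compatible_eq_vanishing M_gt0 M_even zeta_odd zetaM _ I4 f_sym BS).
rewrite -[LHS]setIT -[RHS]setIT -traceT setTE => f_sym.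
exact: (compatible_eq_vanishing M_gt0 M_even zeta_odd zetaM openT _ f_sym BS).
Qed.
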